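(* Let $F$ be the modular form of weight one on $G_3[\sqrt{-3}]$ (with some character $v$) that vanishes along the three mirrors $w_1=0$, $w_2=0$, $w_3=0$ (and whose zero divisor consists exactly of their $G_3[\sqrt{-3}]$-orbits, with multiplicity one). Then for every $a\in\mathcal{E}^4$ with $h(a,a)=-1$, the value $v(\gamma)$ on the triflection $\gamma$ along $a$ is $\zeta$ if $a$ is congruent modulo $\sqrt{-3}$ to one of $\pm(0,1,0,0)$, $\pm(0,0,1,0)$, $\pm(0,0,0,1)$, and is $1$ otherwise.
   Context: $\zeta=(-1+\sqrt{-3})/2$, $\mathcal{E}=\mathbb{Z}[\zeta]$. On $\mathbb{C}^4$ (coordinates $z_0,\dots,z_3$), $h(z,w)=\bar z_0w_0-\bar z_1w_1-\bar z_2w_2-\bar z_3w_3$; $G_3$ is the group of $h$-unitary matrices in $\mathrm{GL}(4,\mathcal{E})$, $G_3[\sqrt{-3}]$ the kernel of reduction modulo $\sqrt{-3}$. $\tilde{\mathcal B}=\{z:h(z,z)>0\}$, identified projectively with the ball via $w_i=z_i/z_0$. A modular form of weight $k$ on $\Gamma$ with character $v$: holomorphic $f$ on $\tilde{\mathcal B}$ with $f(tz)=t^{-k}f(z)$, $f(\gamma z)=v(\gamma)f(z)$, regular at cusps. Such an $F$ of weight one as described exists. For $b\in\mathcal{E}^4$ with $h(b,b)=-1$, the triflection along $b$ is $x\mapsto x-(1-\zeta)\frac{h(b,x)}{h(b,b)}b$; it lies in $G_3[\sqrt{-3}]$. *)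

(* Defs.v *)
From HB Require Import structures.
From mathcomp Require Import all_boot all_order all_algebra.
From mathcomp Require Import all_classical all_reals all_analysis.
From mathcomp.real_closed Require Import complex.
Import Order.TTheory GRing.Theory Num.Theory.
Import numFieldNormedType.Exports.

Set Implicit Arguments.
Unset Strict Implicit.
Unset Printing Implicit Defensive.

Local Open Scope ring_scope.

(* The complex numbers, viewed as a numClosedFieldType (so that
   MathComp-Analysis equips it with its normed / topological structure and
   'cV[CC R]_4 is a normed C-module: differentiability is C-linear). *)
Definition CC (R : realType) : numClosedFieldType := R[i].

Section Defs.
Variable R : realType.
Local Notation C := (CC R).

(* sqrt(-3) (the square root with non-negative argument, i.e. i*sqrt 3) *)
Definition s3 : C := 2.-root (-3 : C).
Definition zeta : C := (-1 + s3) / 2.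

Definition isEis (x : C) : Prop := exists a b : int, x = a%:~R + b%:~R * zeta.

Definition congE (x y : C) : Prop := isEis ((x - y) / s3).

Definition Evec (a : 'cV[C]_4) : Prop := forall i, isEis (a i 0).

Definition Jmx : 'M[C]_4 := diag_mx (\row_(i < 4) (if i == ord0 then 1 else -1)).

Definition herm (z w : 'cV[C]_4) : C := (((map_mx Num.conj z)^T *m Jmx) *m w) 0 0.

Definition G3 (g : 'M[C]_4) : Prop :=
  [/\ forall i j, isEis (g i j),
      g \in unitmx,
      forall i j, isEis (invmx g i j)
    & forall z w, herm (g *m z) (g *m w) = herm z w].

Definition G3s3 (g : 'M[C]_4) : Prop :=
  G3 g /\ forall i j, congE (g i j) ((1%:M : 'M[C]_4) i j).

Definition inB (z : 'cV[C]_4) : Prop := 0 < herm z z.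

Definition modular_form (k : nat) (Gamma : 'M[C]_4 -> Prop)
    (v : 'M[C]_4 -> C) (f : 'cV[C]_4 -> C) : Prop :=
  [/\
      forall z, inB z -> differentiable f z,
      forall (t : C) z, t != 0 -> inB z -> f (t *: z) = t ^- k * f z,
      forall g1 g2, Gamma g1 -> Gamma g2 -> v (g1 *m g2) = v g1 * v g2,
      forall g z, Gamma g -> inB z -> f (g *m z) = v g * f z
    & (* regular at every cusp c (nonzero isotropic vector of E^4): the
         degree-0 function f(z) h(c,z)^k is bounded on a horoball at c *)
      forall c, Evec c -> c != 0 -> herm c c = 0 ->
        exists T M : C, 0 < T /\
          forall z, inB z -> T * `|herm c z| ^+ 2 <= herm z z ->
            `|f z * herm c z ^+ k| <= M].

Definition zero_divisor_mirrors (Gamma : 'M[C]_4 -> Prop)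
    (f : 'cV[C]_4 -> C) : Prop :=
  (forall z, inB z ->
     (f z = 0 <-> exists g, Gamma g /\
                   exists i : 'I_4, i != ord0 /\ (g *m z) i 0 = 0))
  /\ (forall i : 'I_4, i != ord0 ->
       exists p, [/\ inB p, p i 0 = 0 & 'D_(delta_mx i 0) f p != 0]).

(* the triflection along b : x |-> x - (1 - zeta) h(b,x)/h(b,b) b *)
Definition triflection (b : 'cV[C]_4) : 'M[C]_4 :=
  1%:M - ((1 - zeta) / herm b b) *: (b *m ((map_mx Num.conj b)^T *m Jmx)).

Definition cong_pm_basis (a : 'cV[C]_4) : Prop :=
  exists i : 'I_4, i != ord0 /\ exists s : C, (s = 1 \/ s = -1) /\
    forall j : 'I_4, congE (a j 0) (s * (delta_mx i 0 : 'cV[C]_4) j 0).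

End Defs.

(* Main.v *)
Require Import Defs.
From HB Require Import structures.
From mathcomp Require Import all_boot all_order all_algebra.
From mathcomp Require Import all_classical all_reals all_analysis.
From mathcomp.real_closed Require Import complex.
From mathcomp Require Import perm ring lra zify.
Import Order.TTheory GRing.Theory Num.Theory.
Import numFieldNormedType.Exports.
Local Open Scope ring_scope.

Set Implicit Arguments.
Unset Strict Implicit.
Unset Printing Implicit Defensive.

(* The triflection along [a] fixes the mirror [a^⊥] pointwise, so its character
   value is 1 as soon as F does not vanish identically on that mirror.  The zeros
   of F lie on countably many hyperplanes with Eisenstein normals congruent to
   some [e_i]; a curve of degree 3 in [a^⊥] leaves each of them in all but
   finitely many points, unless one of them is [a^⊥] itself, and then [a] is
   congruent to [± e_i].  On the mirror of [e_i], where F vanishes to order one,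
   comparing the normal derivatives of [F] and [F \o triflection] gives [ζ].
   Conversely, if [a] is congruent to [± e_i] then [a] is [±] an element of the
   [G_3[√-3]]-orbit of [e_i]: reduction theory at the cusp [(1, 1, 0, 0)] shows
   that [G_3] is transitive on the vectors of norm [-1], and the resulting element
   of [G_3] is corrected by the stabiliser of [e_1], which surjects onto the
   orthogonal group of the ternary form over [F_3]. *)

(** * Eisenstein integers *)

Section Eisenstein.
Variable R : realType.
Local Notation C := (CC R).
Local Notation θ := (s3 R).
Local Notation ζ := (zeta R).
Implicit Types (x y z : C).

Lemma s3_sqr : θ ^+ 2 = -3.
Proof. by rewrite /s3 rootCK. Qed.

Lemma s3_neq0 : θ != 0.
Proof.
apply/eqP => h; have := s3_sqr; rewrite h expr0n /= => /eqP.
by rewrite eq_sym oppr_eq0 pnatr_eq0.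
Qed.

(** Conjugation fixes the square [-3], so it sends [θ] to [θ] or [- θ]; in the first case [θ] would
    be real with a negative square. *)
Lemma conj_s3 : θ^* = - θ.
Proof.
have : (θ^*) ^+ 2 = θ ^+ 2 by rewrite -rmorphXn /= s3_sqr rmorphN /= rmorph_nat.
move/eqP; rewrite eqf_sqr => /orP[/eqP h|/eqP //].
have : θ \is Num.real by rewrite CrealE h.
by move/real_exprn_even_ge0 => /(_ 2 isT); rewrite s3_sqr oppr_ge0 lern0.
Qed.

Lemma s3E : θ = 2 * ζ + 1.
Proof. by rewrite /zeta; field. Qed.

Lemma zeta_sqr : ζ ^+ 2 = - ζ - 1.
Proof.
have := s3_sqr; rewrite s3E => h.
have -> : ζ ^+ 2 = ((2 * ζ + 1) ^+ 2 - 4 * ζ - 1) / 4 by field.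
by rewrite h; field.
Qed.

Lemma conj_zeta : ζ^* = - ζ - 1.
Proof.
by rewrite /zeta rmorphM rmorphD rmorphN rmorph1 fmorphV rmorph_nat /= conj_s3; field.
Qed.

Lemma isEis_int (n : int) : isEis (n%:~R : C).
Proof. by exists n, 0; rewrite mul0r addr0. Qed.

Lemma isEis_zeta : isEis ζ.
Proof. by exists 0, 1; rewrite mul1r add0r. Qed.

Lemma isEisD x y : isEis x -> isEis y -> isEis (x + y).
Proof.
move=> [a [b ->]] [c [d ->]]; exists (a + c), (b + d).
by rewrite !intrD; ring.
Qed.

Lemma isEisN x : isEis x -> isEis (- x).
Proof. by move=> [a [b ->]]; exists (- a), (- b); rewrite !intrN; ring. Qed.

Lemma isEisB x y : isEis x -> isEis y -> isEis (x - y).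
Proof. by move=> hx /isEisN; apply: isEisD. Qed.

Lemma isEisM x y : isEis x -> isEis y -> isEis (x * y).
Proof.
move=> [a [b ->]] [c [d ->]]; exists (a * c - b * d), (a * d + b * c - b * d).
rewrite !intrD !intrN !intrM.
transitivity (a%:~R * c%:~R + (a%:~R * d%:~R + b%:~R * c%:~R) * ζ
  + b%:~R * d%:~R * ζ ^+ 2); first by ring.
by rewrite zeta_sqr; ring.
Qed.

Lemma isEis_conj x : isEis x -> isEis x^*.
Proof.
move=> [a [b ->]]; exists (a - b), (- b).
by rewrite rmorphD rmorphM !rmorph_int /= conj_zeta !intrD !intrN; ring.
Qed.

Lemma isEis0 : isEis (0 : C). Proof. exact: (isEis_int 0). Qed.
Lemma isEis1 : isEis (1 : C). Proof. exact: (isEis_int 1). Qed.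

Lemma isEis_s3 : isEis θ.
Proof. by rewrite s3E; apply: isEisD isEis1; apply: isEisM isEis_zeta; apply: (isEis_int 2). Qed.

Lemma isEis_sum (I : Type) (r : seq I) (P : pred I) (f : I -> C) :
  (forall i, P i -> isEis (f i)) -> isEis (\sum_(i <- r | P i) f i).
Proof. by move=> h; apply: big_ind => //; [exact: isEis0 | exact: isEisD]. Qed.

(** The norm form [a ^+ 2 - a * b + b ^+ 2] is integral and nonnegative. Heights are therefore
    natural numbers, and the descent terminates. *)
Lemma isEis_norm x : isEis x -> exists n : nat, x * x^* = n%:R.
Proof.
move=> [a [b ->]].
have -> : (a%:~R + b%:~R * ζ) * (a%:~R + b%:~R * ζ)^* =
   (a ^+ 2 - a * b + b ^+ 2)%:~R.
  rewrite rmorphD rmorphM !rmorph_int /= conj_zeta.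
  rewrite !intrD !intrN !rmorphXn /= intrM.
  transitivity ((a%:~R : C) ^+ 2 - a%:~R * b%:~R - b%:~R ^+ 2 * (ζ ^+ 2 + ζ)); first by ring.
  by rewrite zeta_sqr; ring.
have h : 0 <= a ^+ 2 - a * b + b ^+ 2 by nia.
by case: (_ + _) h => // n _; exists n.
Qed.

Definition rc (x : R) : C := (x%:C)%C.

Lemma rcD : {morph rc : x y / x + y}. Proof. exact: raddfD. Qed.
Lemma rcN : {morph rc : x / - x}. Proof. exact: raddfN. Qed.
Lemma rcM : {morph rc : x y / x * y}. Proof. exact: rmorphM. Qed.
Lemma rcX n : {morph rc : x / x ^+ n}. Proof. exact: rmorphXn. Qed.
Lemma rc1 : rc 1 = 1. Proof. by []. Qed.
Lemma rc_int (n : int) : rc n%:~R = n%:~R. Proof. exact: rmorph_int. Qed.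
Lemma rc_nat (n : nat) : rc n%:R = n%:R. Proof. exact: rmorph_nat. Qed.
Lemma rc_le (x y : R) : (rc x <= rc y) = (x <= y). Proof. exact: lecR. Qed.
Lemma rc_lt (x y : R) : (rc x < rc y) = (x < y). Proof. exact: ltcR. Qed.
Lemma rc_conj (x : R) : (rc x)^* = rc x. Proof. exact: conjc_real. Qed.
Lemma rc_inj : injective rc. Proof. by move=> x y []. Qed.


Lemma conj_fix x : x^* = x -> exists a : R, x = rc a.
Proof.
case: x => p q [] hq; exists p.
by congr Complex; lra.
Qed.

Lemma basis_zeta x : exists a b : R, x = rc a + rc b * ζ.
Proof.
have θ0 := s3_neq0.
have [b hb] : exists b : R, (x - x^*) / θ = rc b.
  apply: conj_fix.
  by rewrite rmorphM fmorphV rmorphB /= conjCK conj_s3; field.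
have [a ha] : exists a : R, x - rc b * ζ = rc a.
  apply: conj_fix; rewrite rmorphB rmorphM /= conj_zeta rc_conj.
  have : x - x^* = rc b * θ by rewrite -hb; field.
  rewrite s3E => h; apply/eqP; rewrite -subr_eq0; apply/eqP.
  by transitivity (rc b * (2 * ζ + 1) - (x - x^*)); [ring | rewrite h subrr].
by exists a, b; rewrite -ha; ring.
Qed.

Definition qf (a b : R) : R := a ^+ 2 - a * b + b ^+ 2.

Lemma norm_zeta (a b : R) :
  (rc a + rc b * ζ) * (rc a + rc b * ζ)^* = rc (qf a b).
Proof.
rewrite rmorphD rmorphM /= conj_zeta !rc_conj /qf !expr2 !(rcD, rcN, rcM).
transitivity (rc a * rc a - rc a * rc b - rc b * rc b * (ζ ^+ 2 + ζ)); first by ring.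
by rewrite zeta_sqr; ring.
Qed.

Lemma trace_zeta (a b : R) :
  (rc a + rc b * ζ) + (rc a + rc b * ζ)^* = rc (2 * a - b).
Proof.
by rewrite rmorphD rmorphM /= conj_zeta !rc_conj rcD rcN rcM rc_nat; ring.
Qed.

(* The squared distances from a point of an equilateral triangle of side 1 to
   its vertices, averaged with the barycentric weights [w_i] of the point, give
   [\sum_(i < j) w_i w_j <= 1/3 < 2/5]. *)
Lemma triangle_cover (a b : R) : 0 <= a -> 0 <= b -> a + b <= 1 ->
  [\/ qf a (- b) <= 2/5, qf (a - 1) (- b) <= 2/5 | qf a (1 - b) <= 2/5].
Proof.
move=> a0 b0 ab; rewrite /qf.
case: (leP (a ^+ 2 - a * - b + (- b) ^+ 2) (2/5)) => h1; first by constructor 1.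
case: (leP ((a - 1) ^+ 2 - (a - 1) * - b + (- b) ^+ 2) (2/5)) => h2; first by constructor 2.
case: (leP (a ^+ 2 - a * (1 - b) + (1 - b) ^+ 2) (2/5)) => h3; first by constructor 3.
exfalso; nra.
Qed.

(** Floor in [a] and ceiling in [b] move the point into the rhombus spanned by [1] and [-ζ]. Its
    shorter diagonal cuts it into two equilateral triangles, exchanged by a half-turn. *)
Lemma round_zeta (a b : R) :
  exists m n : int, qf (a + m%:~R) (b + n%:~R) <= 2/5.
Proof.
have a0 : 0 <= a - (Num.floor a)%:~R by rewrite subr_ge0 floor_le.
have a1 : a - (Num.floor a)%:~R <= 1 by have := floorD1_gt a; rewrite intrD => ?; lra.
have b0 : 0 <= (Num.ceil b)%:~R - b by rewrite subr_ge0 ceil_ge.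
have b1 : (Num.ceil b)%:~R - b <= 1 by have := ceilB1_lt b; rewrite intrB => ?; lra.
move: a0 a1 b0 b1.
move: (Num.floor a) (Num.ceil b) => f c.
have -> : a = (a - f%:~R) + f%:~R by ring.
have -> : b = - (c%:~R - b) + c%:~R by ring.
move: (a - f%:~R) (c%:~R - b) => {}a {}b.
rewrite addrK opprD opprK => a0 a1.
have -> : c%:~R + (b - c%:~R) = b by ring.
move=> b0 b1.
case: (leP (a + b) 1) => ab.
  case: (triangle_cover a0 b0 ab) => h.
  - by exists (- f), (- c); apply: le_trans h; rewrite /qf !intrN !addrK.
  - exists (- f - 1), (- c); apply: le_trans h.
    by rewrite /qf intrB !intrN !addrK addrA addrK.
  - by exists (- f), (1 - c); apply: le_trans h; rewrite /qf !(intrB, intrN); nra.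
case: (@triangle_cover (1 - a) (1 - b)); [lra|lra|lra|..] => h.
- by exists (- f - 1), (1 - c); apply: le_trans h; rewrite /qf !(intrB, intrN); nra.
- by exists (- f), (1 - c); apply: le_trans h; rewrite /qf !(intrB, intrN); nra.
- by exists (- f - 1), (- c); apply: le_trans h; rewrite /qf !(intrB, intrN); nra.
Qed.

(** As [2/5 < 1/2], two coordinates reduced in this way have norms summing to less than the norm of
    the divisor, which the descent exploits. *)
Lemma eis_cover x : exists2 l, isEis l & (x + l) * (x + l)^* <= rc (2/5).
Proof.
have [a [b ->]] := basis_zeta x; have [m [n h]] := round_zeta a b.
exists (m%:~R + n%:~R * ζ); first by exists m, n.
rewrite -!rc_int.
have -> : rc a + rc b * ζ + (rc m%:~R + rc n%:~R * ζ) =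
   rc (a + m%:~R) + rc (b + n%:~R) * ζ by rewrite !rcD; ring.
by rewrite norm_zeta rc_le.
Qed.

End Eisenstein.

Local Notation o0 := (@Ordinal 4 0 isT).
Local Notation o1 := (@Ordinal 4 1 isT).
Local Notation o2 := (@Ordinal 4 2 isT).
Local Notation o3 := (@Ordinal 4 3 isT).

Lemma forall_ord4 (P : 'I_4 -> Prop) :
  P o0 -> P o1 -> P o2 -> P o3 -> forall i, P i.
Proof.
move=> h0 h1 h2 h3 [[|[|[|[|]]]] hi] //;
  by rewrite (bool_irrelevance hi isT).
Qed.

Lemma sum_ord4 (V : nmodType) (f : 'I_4 -> V) :
  \sum_i f i = f o0 + f o1 + f o2 + f o3.
Proof.
rewrite !big_ord_recl big_ord0 addr0 !addrA.
by congr (_ + _ + _ + _); congr f; apply: val_inj.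
Qed.

(** * The hermitian form and its integral unitary group *)

Section Unitary.
Variable R : realType.
Local Notation C := (CC R).
Local Notation θ := (s3 R).
Local Notation ζ := (zeta R).
Local Notation J := (Jmx R).
Implicit Types (g k : 'M[C]_4) (a b z w : 'cV[C]_4) (x y t : C).

Definition hadj m n (A : 'M[C]_(m, n)) : 'M[C]_(n, m) := (map_mx Num.conj A)^T.

Lemma hadjM m n p (A : 'M[C]_(m, n)) (B : 'M[C]_(n, p)) :
  hadj (A *m B) = hadj B *m hadj A.
Proof. by rewrite /hadj map_mxM trmx_mul. Qed.

Lemma hadjE m n (A : 'M[C]_(m, n)) i j : hadj A i j = (A j i)^*.
Proof. by rewrite !mxE. Qed.

Lemma hadjZ m n x (A : 'M[C]_(m, n)) : hadj (x *: A) = x^* *: hadj A.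
Proof. by apply/matrixP => i j; rewrite !mxE rmorphM. Qed.

Lemma hermE z w : herm z w =
  (z o0 0)^* * w o0 0 - (z o1 0)^* * w o1 0 - (z o2 0)^* * w o2 0
  - (z o3 0)^* * w o3 0.
Proof.
rewrite /herm /Jmx mxE sum_ord4 !mxE !sum_ord4 !mxE /=.
by rewrite !(mulr0n, mulr1n, mulr0, add0r, addr0, mulr1, mulrN1, mulNr).
Qed.

Lemma herm_conj z w : (herm z w)^* = herm w z.
Proof. by rewrite !hermE !rmorphB !rmorphM /= !conjCK; ring. Qed.

Lemma hermDr z w1 w2 : herm z (w1 + w2) = herm z w1 + herm z w2.
Proof. by rewrite /herm mulmxDr mxE. Qed.

Lemma hermZr z x w : herm z (x *: w) = x * herm z w.
Proof. by rewrite /herm -scalemxAr mxE. Qed.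

Lemma hermDl z1 z2 w : herm (z1 + z2) w = herm z1 w + herm z2 w.
Proof. by rewrite -herm_conj hermDr rmorphD /= !herm_conj. Qed.

Lemma hermZl x z w : herm (x *: z) w = x^* * herm z w.
Proof. by rewrite -herm_conj hermZr rmorphM /= herm_conj. Qed.

Lemma mulJJ : J *m J = 1%:M.
Proof.
rewrite /Jmx mulmx_diag -[RHS]diag_const_mx; congr diag_mx.
by apply/rowP => i; rewrite !mxE; case: eqP => _; ring.
Qed.

Definition Emx m n (A : 'M[C]_(m, n)) := forall i j, isEis (A i j).

Lemma EmxM m n p (A : 'M[C]_(m, n)) (B : 'M[C]_(n, p)) :
  Emx A -> Emx B -> Emx (A *m B).
Proof. by move=> hA hB i j; rewrite mxE; apply: isEis_sum => k _; apply: isEisM. Qed.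

Lemma Emx_hadj m n (A : 'M[C]_(m, n)) : Emx A -> Emx (hadj A).
Proof. by move=> h i j; rewrite hadjE; apply: isEis_conj. Qed.

Lemma Emx1 n : Emx (1%:M : 'M[C]_n).
Proof. by move=> i j; rewrite mxE; apply: (isEis_int _ (i == j)). Qed.

Lemma EmxJ : Emx J.
Proof.
have E1 := @isEis1 R; move=> i j; rewrite !mxE; case: ifP => _; case: (i == j) => //=;
  by (exact: isEis0 || exact: isEisN).
Qed.

Lemma Emx_delta i : Emx (delta_mx i 0 : 'cV[C]_4).
Proof. by move=> k j; rewrite mxE; apply: (isEis_int _ (_ && _)). Qed.

Lemma unitary_J g :
  (forall z w, herm (g *m z) (g *m w) = herm z w) -> hadj g *m J *m g = J.
Proof.
move=> h; apply/matrixP => i j.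
have E (A : 'M[C]_4) : A i j =
    ((delta_mx i 0 : 'cV[C]_4)^T *m A *m (delta_mx j 0 : 'cV[C]_4)) 0 0.
  by rewrite trmx_delta -rowE -colE !mxE.
have D : hadj (delta_mx i 0 : 'cV[C]_4) = (delta_mx i 0)^T.
  by rewrite /hadj map_delta_mx.
have := h (delta_mx i 0) (delta_mx j 0).
by rewrite /herm -!/(hadj _) hadjM D !mulmxA => e; rewrite [LHS]E [RHS]E !mulmxA.
Qed.

(** Since [J *m J = 1], the inverse of [g] is [J *m hadj g *m J], which inherits integrality from
    [g]. *)
Lemma J_G3 g : Emx g -> hadj g *m J *m g = J -> G3 g.
Proof.
move=> hg hJ.
have inv : (J *m hadj g *m J) *m g = 1%:M by rewrite -!mulmxA (mulmxA (hadj g)) hJ mulJJ.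
have [_ ug] := mulmx1_unit inv.
split=> //.
  have -> : invmx g = J *m hadj g *m J by rewrite -[RHS]mulmx1 -(mulmxV ug) mulmxA inv mul1mx.
  by apply: EmxM EmxJ; apply: EmxM EmxJ _; apply: Emx_hadj.
move=> z w; rewrite /herm -!/(hadj _) hadjM !mulmxA -(mulmxA _ (hadj g)).
by rewrite -(mulmxA _ (_ *m _) g) hJ.
Qed.

Lemma G3I g : Emx g -> (forall z w, herm (g *m z) (g *m w) = herm z w) -> G3 g.
Proof. by move=> hg /unitary_J; apply: J_G3. Qed.

Lemma G3_J g : G3 g -> hadj g *m J *m g = J.
Proof. by case=> _ _ _ /unitary_J. Qed.

Lemma G3_1 : G3 (1%:M : 'M[C]_4).
Proof. by apply: G3I; [exact: Emx1 | move=> z w; rewrite !mul1mx]. Qed.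

Lemma G3M g k : G3 g -> G3 k -> G3 (g *m k).
Proof.
move=> [eg _ _ hg] [ek _ _ hk]; apply: G3I; first exact: EmxM.
by move=> z w; rewrite -!mulmxA hg hk.
Qed.

Lemma G3V g : G3 g -> G3 (invmx g).
Proof.
move=> [_ ug ei hg]; apply: G3I => // z w.
by rewrite -hg !mulmxA mulmxV // !mul1mx.
Qed.

Lemma congE_refl x : congE x x.
Proof. by rewrite /congE subrr mul0r; apply: isEis0. Qed.

Lemma congE_sym x y : congE x y -> congE y x.
Proof. by rewrite /congE => /isEisN; rewrite -mulNr opprB. Qed.

Lemma congE_trans y x t : congE x y -> congE y t -> congE x t.
Proof. by rewrite /congE => hx hy; have := isEisD hx hy; rewrite -mulrDl addrA subrK. Qed.

Lemma congED x x' y y' : congE x x' -> congE y y' -> congE (x + y) (x' + y').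
Proof.
rewrite /congE => hx hy; have := isEisD hx hy; rewrite -mulrDl.
by congr (isEis (_ / _)); ring.
Qed.

Lemma congEN x x' : congE x x' -> congE (- x) (- x').
Proof. by rewrite /congE => /isEisN; rewrite -mulNr opprB addrC opprK. Qed.

(** From [x y - x' y' = x (y - y') + (x - x') y'], which is why integrality is asked of [x] and
    [y']. *)
Lemma congEM x x' y y' : isEis x -> isEis y' -> congE x x' -> congE y y' ->
  congE (x * y) (x' * y').
Proof.
rewrite /congE => ex ey hx hy.
have := isEisD (isEisM ex hy) (isEisM hx ey).
by congr isEis; have := s3_neq0 R => ?; field.
Qed.

Lemma congE_conj x x' : congE x x' -> congE x^* x'^*.
Proof.
rewrite /congE => /isEis_conj /isEisN; congr isEis.
rewrite rmorphM fmorphV rmorphB /= conj_s3.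
by have := s3_neq0 R => ?; field.
Qed.

End Unitary.

(** * The congruence subgroup modulo [θ] and its triflections *)

Section Congruence.
Variable R : realType.
Local Notation C := (CC R).
Local Notation θ := (s3 R).
Local Notation ζ := (zeta R).
Local Notation J := (Jmx R).
Implicit Types (g k : 'M[C]_4) (a b z w : 'cV[C]_4) (x y t : C).

Definition mcong m n (A B : 'M[C]_(m, n)) := forall i j, congE (A i j) (B i j).

Lemma mcongM m n p (A A' : 'M[C]_(m, n)) (B B' : 'M[C]_(n, p)) :
  Emx A -> Emx B' -> mcong A A' -> mcong B B' -> mcong (A *m B) (A' *m B').
Proof.
move=> eA eB hA hB i j; rewrite !mxE.
elim/big_rec2: _ => [|l y x _ h]; first exact: congE_refl.
by apply: congED => //; apply: congEM.
Qed.

Lemma mcong_refl m n (A : 'M[C]_(m, n)) : mcong A A.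
Proof. by move=> i j; apply: congE_refl. Qed.

Lemma G3s3_1 : G3s3 (1%:M : 'M[C]_4).
Proof. by split; [exact: G3_1 | exact: mcong_refl]. Qed.

Lemma G3s3V g : G3s3 g -> G3s3 (invmx g).
Proof.
move=> [hg cg]; split; first exact: G3V.
have [eg ug ei _] := hg.
have := mcongM ei (@Emx1 R 4) (mcong_refl _) cg.
by rewrite mulVmx // mulmx1 => h i j; apply: congE_sym.
Qed.

(** Normality of the kernel of reduction; it transports the orbit result from [e_1] to the other
    [e_i]. *)
Lemma G3s3_conjg g k : G3s3 g -> G3 k -> G3s3 (invmx k *m g *m k).
Proof.
move=> [hg cg] hk; have [ek uk ei _] := hk; have [eg _ _ _] := hg.
split; first exact: (G3M (G3M (G3V hk) hg) hk).
have := mcongM (EmxM ei eg) ek (mcongM ei (@Emx1 R 4) (mcong_refl _) cg) (mcong_refl k).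
by rewrite mulmx1 mulVmx.
Qed.

Lemma triflectionE a z : herm a a = -1 ->
  triflection a *m z = z + ((1 - ζ) * herm a z) *: a.
Proof.
move=> ha; rewrite /triflection ha invrN1 mulrN1 scaleNr opprK mulmxDl mul1mx.
rewrite -scalemxAl -mulmxA [X in a *m X]mx11_scalar mul_mx_scalar scalerA.
by [].
Qed.

(** For norm [-1], unitarity comes down to [1 + ζ + ζ ^+ 2 = 0], and the congruence to the
    divisibility of [1 - ζ] by [θ]. *)
Lemma triflection_G3s3 a : Evec a -> herm a a = -1 -> G3s3 (triflection a).
Proof.
move=> ea ha.
have ent i j : triflection a i j = (1%:M : 'M[C]_4) i j + (1 - ζ) * (a *m (hadj a *m J)) i j.
  by rewrite /triflection ha invrN1 mulrN1 scaleNr opprK !mxE.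
have eaa : Emx (a *m (hadj a *m J)).
  have ea' : Emx a by move=> i j; rewrite (ord1 j).
  by apply: EmxM => //; apply: EmxM (@EmxJ R); apply: Emx_hadj.
have e1 : isEis (1 - ζ) by apply: isEisB; [exact: isEis1 | exact: isEis_zeta].
split.
  apply: G3I.
    by move=> i j; rewrite ent; apply: isEisD; [exact: Emx1 | exact: isEisM].
  move=> z w; rewrite !triflectionE // !(hermDl, hermDr, hermZl, hermZr) ha.
  rewrite -(herm_conj a z) !rmorphM rmorphB rmorph1 /= conj_zeta.
  move: (herm z w) (herm a w) ((herm a z)^*) => x y t.
  transitivity (x + t * y * (1 + ζ + ζ ^+ 2)); first by ring.
  by rewrite zeta_sqr; ring.
move=> i j; rewrite /congE ent [_ + _ - _]addrAC subrr add0r mulrAC.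
apply: isEisM => //.
have -> : (1 - ζ) / θ = - 1 - ζ.
  apply: (mulIf (s3_neq0 R)); rewrite divfK ?s3_neq0 // s3E.
  transitivity (- 2 * ζ ^+ 2 - 3 * ζ - 1); last by ring.
  by rewrite zeta_sqr; ring.
by apply: isEisB; [apply: isEisN; exact: isEis1 | exact: isEis_zeta].
Qed.

Lemma triflection_conj g b : G3 g -> herm b b = -1 ->
  triflection (g *m b) *m g = g *m triflection b.
Proof.
move=> hg hb; have hJ := G3_J hg; have [_ _ _ hh] := hg.
rewrite /triflection hh hb mulmxBl mulmxBr mul1mx mulmx1; congr (_ - _).
rewrite -scalemxAl -scalemxAr; congr (_ *: _).
by rewrite -!/(hadj _) hadjM -!mulmxA (mulmxA (hadj g)) hJ.
Qed.

Lemma triflectionZ x b : x * x^* = 1 -> triflection (x *: b) = triflection b.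
Proof.
move=> hx; rewrite /triflection hermZl hermZr -!/(hadj _) hadjZ.
have -> : x^* * (x * herm b b) = (x * x^*) * herm b b by ring.
by rewrite hx mul1r -!scalemxAl -!scalemxAr !scalerA -mulrA hx mulr1.
Qed.

End Congruence.

(** * Multipliers read off from a nonzero directional derivative *)

Section EigenDerivative.
Variables (K : numFieldType) (V : normedModType K).
Local Open Scope classical_set_scope.

Lemma mul_unit_dnbhs (u : K) : `|u| = 1 -> ( *%R u) @ 0^' --> (0 : K)^'.
Proof.
move=> hu A; rewrite /dnbhs /within /= => /nbhs_ballP[e /= e0 he].
apply/nbhs_ballP; exists e => //= h hb h0.
have u0 : u != 0 by rewrite -normr_eq0 hu oner_eq0.
apply: he; last by rewrite mulf_neq0.
by move: hb; rewrite -ball_normE /ball_ /= !sub0r !normrN normrM hu mul1r.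
Qed.

(** As [F p = 0], the quotient [phi h = h^-1 * F (h *: w + p)] tends to [L = 'D_w F p], and so does
    [phi (u * h)]. The functional equation gives the latter the limit [u^-1 * c * L], and [L]
    cancels. A nonzero limit also forces nonzero values of [F] near [p]. *)
Lemma derive_eigen (F : V -> K) (p w : V) (u c e : K) :
  `|u| = 1 -> 0 < e -> derivable F p w -> F p = 0 -> 'D_w F p != 0 ->
  (forall h : K, `|h| < e -> F ((u * h) *: w + p) = c * F (h *: w + p)) ->
  c = u /\ exists2 h : K, `|h| < e & F (h *: w + p) != 0.
Proof.
move=> hu e0 dF Fp L0 hF.
have u0 : u != 0 by rewrite -normr_eq0 hu oner_eq0.
set L := 'D_w F p in L0.
pose phi (h : K) : K := h^-1 * F (h *: w + p).
have cphi : phi @ (0 : K)^' --> L.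
  have := dF; rewrite /derivable => /cvg_ex[l hl].
  have -> : L = l by apply: cvg_lim hl; exact: norm_hausdorff.
  apply: cvg_trans hl; apply: near_eq_cvg; near=> h.
  by rewrite /phi /= Fp subr0.
have near_e : \forall h \near (0 : K)^', `|h| < e.
  apply: nbhs_dnbhs; apply/nbhs_ballP; exists e => //= h.
  by rewrite -ball_normE /ball_ /= sub0r normrN.
have cphi2 : (fun h => phi (u * h)) @ (0 : K)^' --> u^-1 * c * L.
  have : (fun h => u^-1 * c * phi h) @ (0 : K)^' --> u^-1 * c * L.
    by apply: cvgM => //; exact: cvg_cst.
  apply: cvg_trans; apply: near_eq_cvg; near=> h.
  rewrite /phi hF; last by near: h.
  by rewrite invfM; ring.
have cphi3 : (fun h => phi (u * h)) @ (0 : K)^' --> L.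
  exact: cvg_comp (mul_unit_dnbhs hu) cphi.
have E : L = u^-1 * c * L.
  by apply: (cvg_unique _ cphi3 cphi2); exact: norm_hausdorff.
split.
  have : u * L = c * L by rewrite {1}E; field.
  by move/(mulIf L0).
have h2 : \forall h \near (0 : K)^', phi h != 0 by apply: (cvgr_neq0 _ cphi L0).
have [h [h1 h3]] := filter_ex (filterI near_e h2).
exists h => //; apply: contraNneq h3 => h3.
by rewrite /phi h3 mulr0.
Unshelve. all: by end_near.
Qed.

End EigenDerivative.

(** * The character on the triflections along the basis vectors *)

Section MirrorDerivative.
Variable R : realType.
Local Notation C := (CC R).
Local Notation ζ := (zeta R).

Lemma norm_zeta1 : `|ζ| = 1.
Proof.
apply/eqP; rewrite -(@pexpr_eq1 _ _ 2) //; apply/eqP.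
rewrite normCK conj_zeta.
by transitivity (- ζ ^+ 2 - ζ); [ring | rewrite zeta_sqr; ring].
Qed.

Lemma herm_delta (i : 'I_4) (z : 'cV[C]_4) : i != ord0 ->
  herm (delta_mx i 0) z = - z i 0.
Proof.
elim/forall_ord4: i => // _; rewrite hermE !mxE /=;
  by rewrite !(conjC0, conjC1, mul0r, mul1r, subr0, sub0r, oppr0).
Qed.

Lemma triflection_delta_value (F : 'cV[C]_4 -> C) (v : 'M[C]_4 -> C) (i : 'I_4) :
  modular_form 1 (@G3s3 R) v F -> zero_divisor_mirrors (@G3s3 R) F ->
  i != ord0 ->
  v (triflection (delta_mx i 0)) = ζ /\ exists2 z, inB z & F z != 0.
Proof.
move=> [dF _ _ hF _] [hz hd] hi.
have [p [pB pi0 L0]] := hd i hi.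
set w := delta_mx i 0 : 'cV[C]_4.
have hw : herm w w = -1 by rewrite herm_delta // mxE !eqxx.
have ew : Evec w by move=> j; apply: Emx_delta.
have wp : herm w p = 0 by rewrite herm_delta // pi0 oppr0.
have Fp : F p = 0.
  apply/hz => //; exists 1%:M; split; first exact: G3s3_1.
  by exists i; rewrite mul1mx.
(* The norm of [h *: w + p] is [herm p p - |h|^2], so this radius keeps the points in the domain of
   [F]. *)
have e0 : 0 < sqrtC (herm p p) by rewrite sqrtC_gt0.
have inBh h : `|h| < sqrtC (herm p p) -> inB (h *: w + p).
  move=> hh; rewrite /inB !(hermDl, hermDr, hermZl, hermZr) hw wp -(herm_conj w) wp conjC0.
  rewrite !mulr0 addr0 add0r mulrN1 mulrN -normCKC addrC subr_gt0.
  by rewrite -[ltRHS]sqrtCK ltr_pXn2r ?nnegrE ?normr_ge0 // ltW.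
have [|ev [h hh Fh]] := derive_eigen norm_zeta1 e0 (diff_derivable (dF p pB)) Fp L0
    (c := v (triflection w)).
  (* The triflection fixes [p], which is orthogonal to [w], and multiplies [w] by
     [1 - (1 - ζ) = ζ]. *)
  move=> h hh; rewrite -hF; [|exact: triflection_G3s3|exact: inBh].
  congr F; rewrite triflectionE // hermDr hermZr hw wp addr0.
  rewrite [RHS]addrAC -scalerDl; congr (_ *: _ + _); ring.
by split => //; exists (h *: w + p) => //; apply: inBh.
Qed.

End MirrorDerivative.

(** * Generic points of a mirror *)

Section Generic.
Variable R : realType.
Local Notation C := (CC R).
Local Notation ζ := (zeta R).
Local Notation J := (Jmx R).
Local Open Scope classical_set_scope.

(** The roots of all [P i] form a countable set, hence of measure zero, while the interval has
    length [1/2]. *)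
Lemma real_nonroot (I : countType) (P : I -> {poly C}) :
  (forall i, P i != 0) ->
  exists2 t : R, 0 < t < 1/2 & forall i, (P i).[rc t] != 0.
Proof.
move=> P0; apply/not_exists2P => hall.
have cU : countable (\bigcup_(i in [set: I]) [set t : R | root (P i) (rc t)]).
  apply: bigcup_countable => [|i _]; first exact: countableP.
  have [rs hrs] := closed_field_poly_normal (P i).
  apply/finite_set_countable/(sub_finite_set _ (finite_seq [seq complex.Re x | x <- rs])).
  move=> t /=; rewrite hrs rootZ ?lead_coef_eq0 // root_prod_XsubC => ht.
  by apply/mapP; exists (rc t).
have cI : countable (`]0, (1/2)[%classic : set R).
  apply: sub_countable cU; apply: subset_card_le => t /=; rewrite in_itv /= => ht.
  case: (hall t) => [//|hn]; apply: contrapT => hU; apply: hn => i.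
  by apply/negP => hi; apply: hU; exists i.
have := countable_lebesgue_measure0 cI.
rewrite lebesgue_measure_itv /= lte_fin ifT; last by lra.
by rewrite -EFinB => -[]; lra.
Qed.

(** For [herm a a = -1] this is the orthogonal projection onto [a^⊥]; the plus sign comes from the
    negative norm. *)
Definition mirror_proj (a : 'cV[C]_4) : 'M[C]_4 := 1%:M + a *m (hadj a *m J).

Lemma mirror_projE a z : mirror_proj a *m z = z + herm a z *: a.
Proof.
by rewrite /mirror_proj mulmxDl mul1mx -mulmxA [X in a *m X]mx11_scalar mul_mx_scalar.
Qed.

(** Along the projection of the moment curve [(1, t, t^2, t^3)] to the mirror, each Eisenstein
    linear form is a polynomial in [t] of degree at most 3. There are countably many forms, so some
    [t] is a root of none of the nonzero polynomials. A zero polynomial means that the form vanishes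
    on the whole mirror, which is the equation [l *m mirror_proj a = 0]. *)
Lemma mirror_generic (a : 'cV[C]_4) : herm a a = -1 ->
  exists z, [/\ inB z, herm a z = 0 &
    forall l : 'rV[C]_4, Emx l -> (l *m z) 0 0 = 0 -> l *m mirror_proj a = 0].
Proof.
move=> ha.
pose lf (f : {ffun 'I_4 -> int * int}) : 'rV[C]_4 :=
  \row_j ((f j).1%:~R + (f j).2%:~R * ζ).
pose P (f : {ffun 'I_4 -> int * int}) : {poly C} :=
  \poly_(j < 4) (lf f *m mirror_proj a) 0 (inord j).
(* Zero polynomials are replaced by 1 to give a family of nonzero ones. *)
have [|t /andP[t0 t1] ht] := @real_nonroot _ (fun f => if P f == 0 then 1 else P f).
  by move=> f; case: (eqVneq (P f) 0) => // _; exact: oner_neq0.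
pose x : 'cV[C]_4 := \col_j rc t ^+ j.
exists (mirror_proj a *m x); split.
- rewrite mirror_projE /inB.
  (* Projecting away from a negative vector adds [|herm a x|^2] to the norm, so positivity of
     [herm x x] is enough; [t < 1/2] provides it. *)
  have -> : herm (x + herm a x *: a) (x + herm a x *: a) =
      herm x x + herm a x * (herm a x)^*.
    rewrite !(hermDl, hermDr, hermZl, hermZr) ha -(herm_conj a x).
    by move: (herm x x) (herm a x) ((herm a x)^*) => x1 x2 x3; ring.
  apply: ltr_wpDr; first exact: mul_conjC_ge0.
  have -> : herm x x = rc (1 - t ^+ 2 - t ^+ 4 - t ^+ 6).
    rewrite hermE !mxE /= !rmorphXn /= rc_conj !rcD !rcN !rcX (rc_nat R 1); ring.
  rewrite -[0]/(rc 0) rc_lt.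
  have : 0 < t ^+ 2 < 1/4 by nra.
  rewrite (exprM t 2 2) (exprM t 2 3); move: (t ^+ 2) => u hu.
  have u2 : u ^+ 2 < 1/4 by nra.
  have u3 : u ^+ 3 < 1/4 by rewrite exprS; nra.
  by lra.
- by rewrite mirror_projE hermDr hermZr ha mulrN1 subrr.
move=> l el; rewrite mulmxA => lx.
have /choice[f hf] : forall j, exists mn : int * int, l 0 j = mn.1%:~R + mn.2%:~R * ζ.
  by move=> j; have [m [n ->]] := el 0 j; exists (m, n).
have lE : l = lf (finfun f) by apply/rowP => j; rewrite mxE ffunE.
have Px : (P (finfun f)).[rc t] = 0.
  rewrite horner_poly -[RHS]lx mxE; apply: eq_bigr => j _.
  by rewrite inord_val lE !mxE.
have := ht (finfun f); case: (eqVneq (P (finfun f)) 0) => [P0 _|_]; last by rewrite Px eqxx.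
apply/rowP => j; rewrite [RHS]mxE.
have := congr1 (fun p : {poly C} => p`_j) P0.
by rewrite coef_poly ltn_ord inord_val coef0 -lE.
Qed.

End Generic.

(** * Residues modulo [θ], and mirrors on which [F] is not identically zero *)

Section Residues.
Variable R : realType.
Local Notation C := (CC R).
Local Notation θ := (s3 R).
Local Notation ζ := (zeta R).

Lemma congE_zeta : congE ζ 1.
Proof.
rewrite /congE; have -> : (ζ - 1) / θ = 1 + ζ.
  apply: (mulIf (s3_neq0 R)); rewrite divfK ?s3_neq0 // s3E.
  transitivity (2 * ζ ^+ 2 + 3 * ζ + 1); last by ring.
  by rewrite zeta_sqr; ring.
by apply: isEisD; [exact: isEis1 | exact: isEis_zeta].
Qed.

Lemma congE_mul3 (n : int) : congE (3 * n%:~R : C) 0.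
Proof.
rewrite /congE subr0; have -> : 3 * n%:~R / θ = (- n)%:~R * θ.
  by apply: (mulIf (s3_neq0 R)); rewrite divfK ?s3_neq0 // -mulrA -expr2 s3_sqr intrN; ring.
by apply: isEisM; [exact: isEis_int | exact: isEis_s3].
Qed.

(** The residue field is [F_3]: [ζ] is congruent to 1, so [m + n ζ] reduces to [m + n], and
    [3 = - θ ^+ 2] reduces that integer modulo 3. *)
Lemma isEis_residue (x : C) : isEis x -> [\/ congE x 0, congE x 1 | congE x (-1)].
Proof.
move=> [m [n ->]].
have h : congE (m%:~R + n%:~R * ζ) (m + n)%:~R.
  rewrite intrD -[X in _ (_ + X)]mulr1; apply: congED; first exact: congE_refl.
  by apply: congEM; [exact: isEis_int | exact: isEis1 | exact: congE_refl | exact: congE_zeta].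
move: (m + n) h => k h.
have [q [r [kE hr]]] : exists q r : int, k = 3 * q + r /\ [\/ r = 0, r = 1 | r = -1].
  have [r0 | r1 | r2] : [\/ k = 3 * (k %/ 3)%Z, k = 3 * (k %/ 3)%Z + 1 | k = 3 * (k %/ 3)%Z + 2].
    have := divz_eq k 3; have := modz_ge0 k (isT : 3 != 0 :> int).
    have := ltz_pmod k (isT : 0 < 3 :> int); move: (k %/ 3)%Z (k %% 3)%Z => q r.
    move=> h1 h2 h3.
    have : r = 0 \/ r = 1 \/ r = 2 by lia.
    by case=> [|[]] hr; [constructor 1 | constructor 2 | constructor 3]; lia.
  - by exists (k %/ 3)%Z, 0; split; [lia | constructor 1].
  - by exists (k %/ 3)%Z, 1; split; [lia | constructor 2].
  - by exists ((k %/ 3)%Z + 1), (-1); split; [lia | constructor 3].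
have h2 : congE (m%:~R + n%:~R * ζ) r%:~R.
  apply: congE_trans h _; rewrite kE intrD intrM -[X in congE _ X]add0r.
  by apply: congED; [exact: congE_mul3 | exact: congE_refl].
by case: hr h2 => ->; [constructor 1 | constructor 2 | constructor 3].
Qed.

(** The norm of [n / θ] is [n^2 / 3]; its integrality gives [3 | n^2]. *)
Lemma congE_int0 (n : int) : congE (n%:~R : C) 0 -> (3 %| n)%Z.
Proof.
rewrite /congE subr0 => /isEis_norm[k hk].
have : (n ^+ 2)%:~R = (3 * k%:Z)%:~R :> C.
  have cn : (n%:~R / θ)^* = - (n%:~R / θ).
    by rewrite rmorphM fmorphV /= rmorph_int conj_s3; have := s3_neq0 R => ?; field.
  rewrite cn in hk; rewrite rmorphXn intrM /= -[k%:~R]/(k%:R) -hk.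
  have -> : 3%:~R = - θ ^+ 2 by rewrite s3_sqr opprK.
  by have := s3_neq0 R => ?; field.
move/intr_inj => h.
have : (3 %| n ^+ 2)%Z by rewrite h dvdz_mulr.
by rewrite !dvdzE abszX Euclid_dvdX // andbT.
Qed.

Lemma congE_1_0 : ~ congE (1 : C) 0.
Proof. by move/(congE_int0 (n := 1)). Qed.

(** A form vanishing on [a^⊥] is a multiple [s] of [herm a], and evaluation at [a] gives [s]. Modulo
    [θ] this [s] is a sign, and dividing by it determines the residue of [a]. *)
Lemma mirror_proportional_cong (a : 'cV[C]_4) (l : 'rV[C]_4) (i : 'I_4) :
  Evec a -> Emx l -> i != ord0 -> (forall j, congE (l 0 j) (i == j)%:R) ->
  l *m mirror_proj a = 0 -> cong_pm_basis a.
Proof.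
move=> ea el hi cl h.
pose s := - (l *m a) 0 0.
have lE j : l 0 j = s * ((a j 0)^* * (if j == ord0 then 1 else -1)).
  have : (l *m mirror_proj a) 0 j = 0 by rewrite h mxE.
  rewrite /mirror_proj mulmxDr mulmx1 mulmxA [l *m a]mx11_scalar mul_scalar_mx mxE.
  rewrite [X in _ + X]mxE => /eqP; rewrite addr_eq0 => /eqP ->.
  rewrite /s mulNr; congr (- (_ * _)).
  by rewrite /Jmx mul_mx_diag !mxE.
have es : isEis s.
  by apply: isEisN; apply: (EmxM el) => k j; rewrite (ord1 j).
(* If [θ] divided [s], it would divide [l 0 i], which is congruent to 1. *)
have hs : congE s 1 \/ congE s (-1).
  case: (isEis_residue es) => [s0|s1|s2]; [exfalso | by left | by right].
  apply: congE_1_0; apply: congE_trans (_ : congE _ (l 0 i)) _.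
    by apply: congE_sym; have := cl i; rewrite eqxx.
  rewrite lE -(mul0r ((a i 0)^* * (if i == ord0 then 1 else -1))).
  apply: congEM => //; last exact: congE_refl.
  apply: isEisM; first exact: isEis_conj.
  by case: ifP => _; [exact: isEis1 | apply: isEisN; exact: isEis1].
have [c hc sc] : exists2 c : C, c = 1 \/ c = -1 & congE s c.
  by case: hs => ?; [exists 1 => //; left | exists (-1) => //; right].
have ec : isEis c by case: hc => ->; [exact: isEis1 | apply: isEisN; exact: isEis1].
(* The minus sign is the entry of [J] at the index [i]. *)
exists i; split => //; exists (- c); split.
  by case: hc => ->; [right | left; rewrite opprK].
move=> j; rewrite -[a j 0]conjCK.
have -> : - c * (delta_mx i 0 : 'cV[C]_4) j 0 = (- c * (delta_mx i 0 : 'cV[C]_4) j 0)^*.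
  by rewrite rmorphM rmorphN mxE /= andbT rmorph_nat; case: hc => ->;
    rewrite ?rmorphN1 ?rmorph1.
apply: congE_conj.
pose e : C := if j == ord0 then 1 else -1.
have ee : e * e = 1 by rewrite /e; case: ifP => _; ring.
have cc : c * c = 1 by case: hc => ->; ring.
have eE : isEis e by rewrite /e; case: ifP => _; [exact: isEis1 | apply: isEisN; exact: isEis1].
have -> : (a j 0)^* = (c * e) * (c * ((a j 0)^* * e)).
  by transitivity ((c * c) * (e * e) * (a j 0)^*); [rewrite ee cc !mul1r | ring].
have -> : - c * (delta_mx i 0 : 'cV[C]_4) j 0 = (c * e) * (i == j)%:R.
  rewrite mxE andbT eq_sym /e; case: (eqVneq i j) => [<-|_]; last by rewrite !mulr0.
  by rewrite (negPf hi) !mulr1 mulrN1.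
apply: congEM; [exact: isEisM | exact: (isEis_int _ (i == j)) | exact: congE_refl |].
apply: congE_trans (cl j); rewrite lE; apply: congE_sym.
apply: congEM => //; last exact: congE_refl.
by apply: isEisM => //; apply: isEis_conj.
Qed.

(** A zero of [F] at the generic point of the mirror lies on the kernel of row [i] of a group
    element. That row then vanishes on the whole mirror, and its residue forces [a] to be congruent
    to [± e_i]. *)
Lemma triflection_trivial_value (F : 'cV[C]_4 -> C) (v : 'M[C]_4 -> C) (a : 'cV[C]_4) :
  modular_form 1 (@G3s3 R) v F -> zero_divisor_mirrors (@G3s3 R) F ->
  Evec a -> herm a a = -1 -> ~ cong_pm_basis a -> v (triflection a) = 1.
Proof.
move=> [_ _ _ hF _] [hz _] ea ha nc.
have [z [zB az hl]] := mirror_generic ha.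
have Fz : F z != 0.
  apply/eqP => /(hz z zB)[g [[[eg _ _ _] cg] [i [hi giz]]]]; apply: nc.
  apply: (@mirror_proportional_cong a (row i g) i) => //.
  - by move=> k j; rewrite mxE.
  - by move=> j; rewrite mxE; have := cg i j; rewrite mxE.
  apply: hl; first by move=> k j; rewrite mxE.
  by rewrite -row_mul mxE.
have := hF _ _ (triflection_G3s3 ea ha) zB.
rewrite triflectionE // az mulr0 scale0r addr0 => /eqP.
by rewrite -[X in X == _]mul1r => /eqP /(mulIf Fz).
Qed.

End Residues.

(** * Transitivity on vectors of norm -1 *)

Section Orbit.
Variable R : realType.
Local Notation C := (CC R).
Local Notation θ := (s3 R).
Local Notation ζ := (zeta R).
Implicit Types (g k : 'M[C]_4) (a b z w : 'cV[C]_4) (x y t u : C).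

Definition mx4 (s : seq (seq C)) : 'M[C]_4 :=
  \matrix_(i, j) nth 0 (nth [::] s i) j.

(* Unitary translation fixing the isotropic vector [(1, 1, 0, 0)]. *)
Definition heis (l2 l3 t : C) : 'M[C]_4 := mx4
  [:: [:: 1 + t; - t; l2^*; l3^*]; [:: t; 1 - t; l2^*; l3^*];
      [:: l2; - l2; 1; 0]; [:: l3; - l3; 0; 1]].

Lemma heisE l2 l3 t z : let m := z o0 0 - z o1 0 in
  let c := l2^* * z o2 0 + l3^* * z o3 0 + t * m in
  [/\ (heis l2 l3 t *m z) o0 0 = z o0 0 + c,
      (heis l2 l3 t *m z) o1 0 = z o1 0 + c,
      (heis l2 l3 t *m z) o2 0 = z o2 0 + l2 * m &
      (heis l2 l3 t *m z) o3 0 = z o3 0 + l3 * m].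
Proof. by split; rewrite mxE sum_ord4 !mxE /=; ring. Qed.

Lemma heis_G3 l2 l3 t : isEis l2 -> isEis l3 -> isEis t ->
  t + t^* = l2 * l2^* + l3 * l3^* -> G3 (heis l2 l3 t).
Proof.
move=> e2 e3 et ht; apply: G3I.
  have E0 := @isEis0 R; have E1 := @isEis1 R.
  have c2 := isEis_conj e2; have c3 := isEis_conj e3.
  have n2 := isEisN e2; have n3 := isEisN e3; have nt := isEisN et.
  have p := isEisD E1 et; have q := isEisB E1 et.
  by elim/forall_ord4; elim/forall_ord4; rewrite mxE.
have tE : t^* = l2 * l2^* + l3 * l3^* - t by rewrite -ht addrC addKr.
move=> z w; have [z0 z1 z2 z3] := heisE l2 l3 t z; have [w0 w1 w2 w3] := heisE l2 l3 t w.
rewrite !hermE z0 z1 z2 z3 w0 w1 w2 w3.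
move: (z o0 0) (z o1 0) (z o2 0) (z o3 0) => {z0 z1 z2 z3} p0 p1 p2 p3.
move: (w o0 0) (w o1 0) (w o2 0) (w o3 0) => {w0 w1 w2 w3} q0 q1 q2 q3.
rewrite !(rmorphD, rmorphN, rmorphM) /= !conjCK tE.
by ring.
Qed.

(** Since [ζ + ζ^* = -1], every integer [n] is the trace of [- n ζ]. Hence [heis l2 l3 t] has an
    admissible [t] for all Eisenstein [l2], [l3]. *)
Lemma isEis_half_norm x : isEis x -> exists2 t, isEis t & t + t^* = x * x^*.
Proof.
move=> /isEis_norm[n hn]; exists (- (n%:R * ζ)).
  by apply: isEisN; apply: isEisM; [exact: (isEis_int _ n) | exact: isEis_zeta].
by rewrite hn rmorphN rmorphM /= rmorph_nat conj_zeta; ring.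
Qed.

Lemma diag_G3 (d : 'rV[C]_4) : (forall i, isEis (d 0 i)) ->
  (forall i, d 0 i * (d 0 i)^* = 1) -> G3 (diag_mx d).
Proof.
move=> ed dd; apply: G3I.
  by move=> i j; rewrite mxE; case: (i == j); [exact: ed | exact: isEis0].
move=> z w; rewrite !hermE !mul_diag_mx !mxE !rmorphM /=.
have h i : (d 0 i)^* * (z i 0)^* * (d 0 i * w i 0) = (z i 0)^* * w i 0.
  by transitivity ((d 0 i * (d 0 i)^*) * ((z i 0)^* * w i 0)); [ring | rewrite dd mul1r].
by rewrite !h.
Qed.

Lemma tperm_G3 (i j : 'I_4) : i != ord0 -> j != ord0 -> G3 (tperm_mx i j : 'M[C]_4).
Proof.
move=> hi hj; apply: G3I.
  by move=> k l; rewrite !mxE; exact: (isEis_int _ (_ == _)).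
move=> z w; rewrite -!row_permE.
have E (p q : 'cV[C]_4) : herm p q = \sum_k (if k == ord0 then 1 else -1) * ((p k 0)^* * q k 0).
  by rewrite hermE sum_ord4 /= !mul1r !mulN1r.
rewrite !E [RHS](reindex_inj (@perm_inj _ (tperm i j))) /=.
apply: eq_bigr => k _; rewrite !mxE; congr (_ * _).
by case: tpermP => [->|->|//]; rewrite (negPf hi) (negPf hj).
Qed.

Lemma tperm_mx_delta (i j : 'I_4) :
  (tperm_mx i j : 'M[C]_4) *m delta_mx i 0 = (delta_mx j 0 : 'cV[C]_4).
Proof.
rewrite -row_permE; apply/matrixP => k l; rewrite !mxE; congr (nat_of_bool (_ && _))%:R.
by rewrite -{2}(tpermR i j) (inj_eq perm_inj).
Qed.

Definition reach a := exists2 g, G3 g & g *m delta_mx o1 0 = a.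

Lemma reach_G3 g a : G3 g -> reach (g *m a) -> reach a.
Proof.
move=> hg [k hk e]; exists (invmx g *m k); first exact: G3M (G3V hg) hk.
by have [_ ug _ _] := hg; rewrite -mulmxA e mulmxA mulVmx // mul1mx.
Qed.

Lemma reach_basis u i : i != ord0 -> isEis u -> u * u^* = 1 ->
  reach (u *: delta_mx i 0).
Proof.
move=> hi eu uu; exists (diag_mx (const_mx u) *m tperm_mx o1 i).
  by apply: G3M; [apply: diag_G3 => j; rewrite mxE | exact: tperm_G3].
by rewrite -mulmxA tperm_mx_delta diag_const_mx mul_scalar_mx.
Qed.

(* Here [M = |m|^2] for [m = a_0 - a_1], [a + b ζ = a_1 / m], and [n2], [n3] are
   the norms of the last two coordinates; the last two alternatives say that
   [|a_1 / m - ζ| < 1] and [|a_1 / m - ζ^2| < 1]. *)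
Lemma descent_real (M n2 n3 a b : R) : 1 <= M -> 0 <= n2 -> n2 <= 2/5 * M ->
  0 <= n3 -> n3 <= 2/5 * M -> (2 * a - b + 1) * M = n2 + n3 - 1 ->
  -1 <= b -> b <= 1 ->
  [\/ [/\ a = -1, b = 0, n2 = 0, n3 = 0 & M = 1], qf a (b - 1) < 1
    | qf (a + 1) (b + 1) < 1].
Proof.
move=> M1 n20 n2M n30 n3M; set d := 2 * a - b + 1 => hd b1 b2.
(* In terms of [d], one plus the trace of [a + b ζ], both norms become sums of squares. *)
have aE : a = (d + b - 1) / 2 by rewrite /d; field.
have q1 : qf a (b - 1) = (3 * (b - 1) ^+ 2 + d ^+ 2) / 4 by rewrite aE /qf; field.
have q2 : qf (a + 1) (b + 1) = (3 * (b + 1) ^+ 2 + d ^+ 2) / 4 by rewrite aE /qf; field.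
rewrite q1 q2 aE.
clearbody d; clear aE q1 q2.
have d1 : d < 1 by nra.
have d0 : -1 <= d by nra.
(* The sign of [b] selects the nearer of [ζ] and [ζ ^+ 2]. On the tie [b = 0] the estimate fails
   only for [d = -1], which forces [M = 1] and [n2 = n3 = 0]. *)
case: (ltgtP b 0) => hb.
- by constructor 3; nra.
- by constructor 2; nra.
case: (ltP (-1) d) => hd1; first by constructor 2; rewrite hb; nra.
have dE : d = -1 by apply/eqP; rewrite eq_le hd1 d0.
rewrite dE in hd *; by constructor 1; split => //; lra.
Qed.

(** The period 2 is the [ζ]-coordinate of [θ = 2 ζ + 1], whose integer multiples can be added to [t]
    without changing its trace. *)
Lemma center_zeta (b : R) : exists2 k : int, -1 <= b + 2 * k%:~R & b + 2 * k%:~R <= 1.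
Proof.
exists (- Num.floor ((b + 1) / 2)); rewrite intrN.
  by have := floor_le ((b + 1) / 2); lra.
by have := floorD1_gt ((b + 1) / 2); rewrite intrD => ?; lra.
Qed.

Lemma Evec_mul g a : G3 g -> Evec a -> Evec (g *m a).
Proof.
move=> [eg _ _ _] ea i; apply: EmxM => // k j; by rewrite (ord1 j).
Qed.

Lemma norm_eq0 x : x * x^* = 0 -> x = 0.
Proof. by move/eqP; rewrite mul_conjC_eq0 => /eqP. Qed.

(** Here [a] is orthogonal to the cusp [(1, 1, 0, 0)]. The norms of its last two coordinates add up
    to 1, so one is a unit and the other is zero; a translation clears the first two. *)
Lemma reach_isotropic a : Evec a -> herm a a = -1 -> a o0 0 = a o1 0 -> reach a.
Proof.
move=> ea; rewrite hermE => ha a01.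
have [n2 h2] := isEis_norm (ea o2); have [n3 h3] := isEis_norm (ea o3).
have hn : (n2 + n3)%N = 1%N.
  apply/eqP; rewrite -(eqr_nat C) natrD -h2 -h3; apply/eqP.
  by rewrite -[RHS]opprK -ha a01; ring.
pose c := a o0 0.
(* Chosen so that [l2^* a_2 + l3^* a_3 = - c (|a_2|^2 + |a_3|^2) = - c]. *)
pose l2 := - (c^* * a o2 0); pose l3 := - (c^* * a o3 0).
have e2 : isEis l2 by apply: isEisN; apply: isEisM (ea _); apply: isEis_conj; exact: ea.
have e3 : isEis l3 by apply: isEisN; apply: isEisM (ea _); apply: isEis_conj; exact: ea.
have [t2 et2 ht2] := isEis_half_norm e2; have [t3 et3 ht3] := isEis_half_norm e3.
apply: (@reach_G3 (heis l2 l3 (t2 + t3))).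
  by apply: heis_G3 => //; [exact: isEisD | rewrite rmorphD /= -ht2 -ht3; ring].
have [z0 z1 z2 z3] := heisE l2 l3 (t2 + t3) a.
have E0 : l2^* * a o2 0 + l3^* * a o3 0 = - c.
  rewrite /l2 /l3 !(rmorphN, rmorphM) /= conjCK.
  transitivity (- (c * (a o2 0 * (a o2 0)^* + a o3 0 * (a o3 0)^*))); first by ring.
  by rewrite h2 h3 -natrD hn mulr1.
rewrite a01 subrr !mulr0 !addr0 E0 -/c in z0 z1 z2 z3.
rewrite -a01 -/c subrr in z0 z1.
move: (heis _ _ _ *m a) z0 z1 z2 z3 => a' z0 z1 z2 z3.
case: n2 n3 hn h2 h3 => [|[|//]] [|[|//]] // _ h2 h3.
  have -> : a' = a o3 0 *: delta_mx o3 0.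
    apply/matrixP => i j; rewrite (ord1 j); move: i {j}; elim/forall_ord4;
      by rewrite !mxE ?z0 ?z1 ?z2 ?z3 /= ?(norm_eq0 h2) ?mulr0 ?mulr1.
  by apply: reach_basis.
have -> : a' = a o2 0 *: delta_mx o2 0.
  apply/matrixP => i j; rewrite (ord1 j); move: i {j}; elim/forall_ord4;
    by rewrite !mxE ?z0 ?z1 ?z2 ?z3 /= ?(norm_eq0 h3) ?mulr0 ?mulr1.
by apply: reach_basis.
Qed.

Lemma twist_G3 u : isEis u -> u * u^* = 1 ->
  G3 (diag_mx (\row_i if i == o1 then u else 1)).
Proof.
move=> eu uu; apply: diag_G3 => i; rewrite mxE; case: ifP => _ //.
  exact: isEis1.
by rewrite rmorph1 mulr1.
Qed.

Lemma zeta_unit : ζ * ζ^* = 1.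
Proof. by rewrite conj_zeta; transitivity (- ζ ^+ 2 - ζ); [ring | rewrite zeta_sqr; ring]. Qed.

(** The squared modulus of [herm c a] for the cusp [c = (1, 1, 0, 0)]. *)
Definition height a := (a o0 0 - a o1 0) * (a o0 0 - a o1 0)^*.

Lemma height_twist u a : height (diag_mx (\row_i if i == o1 then u else 1) *m a) =
  (a o0 0 - u * a o1 0) * (a o0 0 - u * a o1 0)^*.
Proof. by rewrite /height mul_diag_mx !mxE /= mul1r. Qed.

(* Reduction of [a] to a fundamental domain of the stabiliser of the cusp
   [(1, 1, 0, 0)], followed by a unit on the second coordinate. *)
Lemma height_descent a : Evec a -> herm a a = -1 -> a o0 0 != a o1 0 ->
  reach a \/ exists2 g, G3 g & height (g *m a) < height a.
Proof.
move=> ea ha a01.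
set m := a o0 0 - a o1 0.
have m0 : m != 0 by rewrite subr_eq0.
have em : isEis m by exact: isEisB.
have [M hM] := isEis_norm em.
have [l2 e2 c2] := eis_cover (a o2 0 / m).
have [l3 e3 c3] := eis_cover (a o3 0 / m).
have [t2 et2 ht2] := isEis_half_norm e2; have [t3 et3 ht3] := isEis_half_norm e3.
have [al [be hy]] := basis_zeta
  ((a o1 0 + l2^* * a o2 0 + l3^* * a o3 0) / m + (t2 + t3)).
have [k k1 k2] := center_zeta be.
(* The last summand has trace zero and moves the [ζ]-coordinate of [a'_1 / m] into [[-1, 1]]. *)
pose t := t2 + t3 + k%:~R * θ.
have hg : G3 (heis l2 l3 t).
  apply: heis_G3 => //.
    by apply: isEisD; [exact: isEisD | apply: isEisM; [exact: isEis_int | exact: isEis_s3]].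
  by rewrite -ht2 -ht3 /t !(rmorphD, rmorphM) /= rmorph_int conj_s3; ring.
have [z0 z1 z2 z3] := heisE l2 l3 t a; rewrite -/m in z0 z1 z2 z3.
set a' := heis l2 l3 t *m a in z0 z1 z2 z3.
have ea' : Evec a' by exact: Evec_mul.
have ha' : herm a' a' = -1 by have [_ _ _ ->] := hg.
set A := al + k%:~R; set B := be + 2 * k%:~R in k1 k2.
pose y := rc A + rc B * ζ.
have z1' : a' o1 0 = y * m.
  have -> : y = (a o1 0 + l2^* * a o2 0 + l3^* * a o3 0) / m + (t2 + t3) + k%:~R * θ.
    by rewrite hy /y /A /B s3E !rcD rcM !rc_int rc_nat; ring.
  by rewrite z1 /t; field.
have z0' : a' o0 0 = (1 + y) * m.
  rewrite mulrDl -z1' z0 z1 mul1r.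
  by rewrite /m; ring.
have [n2 h2] := isEis_norm (ea' o2); have [n3 h3] := isEis_norm (ea' o3).
have bound (x l : C) (n : nat) : (x / m + l) * (x / m + l)^* <= rc (2/5) ->
    (x + l * m) * (x + l * m)^* = n%:R -> (n%:R : R) <= 2/5 * M%:R.
  move=> h1 h; rewrite -rc_le rcM !rc_nat -h -hM.
  have -> : (x + l * m) * (x + l * m)^* = ((x / m + l) * (x / m + l)^*) * (m * m^*).
    have -> : x + l * m = (x / m + l) * m by field.
    by rewrite rmorphM; ring.
  by apply: ler_wpM2r => //; exact: mul_conjC_ge0.
rewrite z2 in h2; rewrite z3 in h3.
have b2 := bound _ _ _ c2 h2; have b3 := bound _ _ _ c3 h3.
have M1 : (1 : R) <= M%:R.
  rewrite ler1n lt0n; apply/eqP => M0; move: hM; rewrite M0 => /norm_eq0 /eqP.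
  by rewrite (negPf m0).
(* This is [herm a' a' = -1], using [|1 + y|^2 - |y|^2 = 1 + y + y^*]. *)
have hrel : (2 * A - B + 1) * M%:R = n2%:R + n3%:R - 1.
  apply: (@rc_inj R); rewrite rcM !rcD !rcN !rc_nat !rc1 -rcN -rcD -trace_zeta -/y.
  have h2' : (a' o2 0)^* * a' o2 0 = n2%:R by rewrite z2 mulrC.
  have h3' : (a' o3 0)^* * a' o3 0 = n3%:R by rewrite z3 mulrC.
  move: ha'; rewrite hermE z0' z1' h2' h3' -hM !rmorphM rmorphD rmorph1 /= => h.
  rewrite -h; ring.
have shrink (c s : C) (q : R) x : q < 1 -> x = c * s * m -> c * c^* = 1 ->
    s * s^* = rc q -> x * x^* < m * m^*.
  move=> q1 -> cc ss.
  have -> : c * s * m * (c * s * m)^* = (c * c^*) * (s * s^*) * (m * m^*).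
    by rewrite !rmorphM /=; ring.
  rewrite cc ss mul1r gtr_pMl ?mul_conjC_gt0 //.
  by rewrite -rc1 rc_lt.
case: (descent_real M1 (ler0n _ n2) b2 (ler0n _ n3) b3 hrel k1 k2)
    => [[A1 B0 n20 n30 M11]|q|q].
- left; apply: (reach_G3 hg); rewrite -/a'.
  have y1 : y = -1 by rewrite /y A1 B0 rcN rc1 mul0r addr0.
  move/eqP: n20; rewrite pnatr_eq0 => /eqP n20.
  move/eqP: n30; rewrite pnatr_eq0 => /eqP n30.
  rewrite n20 -z2 in h2; rewrite n30 -z3 in h3.
  have -> : a' = (- m) *: delta_mx o1 0.
    apply/matrixP => i j; rewrite (ord1 j); move: i {j}; elim/forall_ord4;
      rewrite [RHS]mxE [X in _ = _ * X]mxE /= ?mulr0 ?mulr1.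
    + by rewrite z0' y1 subrr mul0r.
    + by rewrite z1' y1 mulN1r.
    + exact: norm_eq0.
    + exact: norm_eq0.
  apply: reach_basis => //; first exact: isEisN.
  rewrite rmorphN /= mulrNN hM; apply/eqP.
  by move/eqP: M11; rewrite !pnatr_eq1.
(* After this twist the difference of the first two coordinates is
   [(1 + y + ζ y) m = (1 + ζ) (y - ζ) m], with [1 + ζ] a unit. *)
- right; exists (diag_mx (\row_i if i == o1 then - ζ else 1) *m heis l2 l3 t).
    apply: G3M hg; apply: twist_G3; first by apply: isEisN; exact: isEis_zeta.
    by rewrite rmorphN /= mulrNN zeta_unit.
  rewrite -mulmxA -/a' height_twist z0' z1' /height -/m.
  apply: (shrink (1 + ζ) (y - ζ) _ _ q).
  + by transitivity (((1 + ζ) * y - ζ - ζ ^+ 2) * m); [rewrite zeta_sqr; ring | ring].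
  + by rewrite rmorphD rmorph1 /= conj_zeta -[RHS](opprK 1); transitivity (- ζ ^+ 2 - ζ);
      [ring | rewrite zeta_sqr; ring].
  + rewrite -norm_zeta (rcD B) rcN rc1.
    by have -> : y - ζ = rc A + (rc B - 1) * ζ by rewrite /y; ring.
(* Here the difference is [(1 - ζ y) m = - ζ (y - ζ ^+ 2) m]. *)
right; exists (diag_mx (\row_i if i == o1 then 1 + ζ else 1) *m heis l2 l3 t).
  apply: G3M hg; apply: twist_G3; first by apply: isEisD; [exact: isEis1 | exact: isEis_zeta].
  by rewrite rmorphD rmorph1 /= conj_zeta; transitivity (- ζ ^+ 2 - ζ);
      [ring | rewrite zeta_sqr; ring].
rewrite -mulmxA -/a' height_twist z0' z1' /height -/m.
apply: (shrink (- ζ) (y + 1 + ζ) _ _ q).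
+ by transitivity ((- ζ * y - ζ - ζ ^+ 2) * m); [rewrite zeta_sqr; ring | ring].
+ by rewrite rmorphN /= mulrNN zeta_unit.
+ rewrite -norm_zeta (rcD A) (rcD B) rc1.
  by have -> : y + 1 + ζ = rc A + 1 + (rc B + 1) * ζ by rewrite /y; ring.
Qed.

Lemma reach_all a : Evec a -> herm a a = -1 -> reach a.
Proof.
move=> ea ha; have [n hn] := isEis_norm (isEisB (ea o0) (ea o1)).
elim/ltn_ind: n a ea ha hn => n IH a ea ha hn.
have [/eqP a01|a01] := boolP (a o0 0 == a o1 0); first exact: reach_isotropic.
have [//|[g hg hlt]] := height_descent ea ha a01.
apply: (reach_G3 hg).
have eg := Evec_mul hg ea.
have [k hk] := isEis_norm (isEisB (eg o0) (eg o1)).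
apply: (IH k) => //; last by have [_ _ _ ->] := hg.
by move: hlt; rewrite /height hk hn ltr_nat.
Qed.

End Orbit.

(** * Lifting isometries modulo the square root of -3 *)

Section Lift.
Variable R : realType.
Local Notation C := (CC R).
Local Notation ζ := (zeta R).
Local Notation e_ i := (delta_mx i 0 : 'cV[C]_4).
Implicit Types (g k : 'M[C]_4) (a b z w : 'cV[C]_4) (x y t u : C).

(** Integer representatives of [F_3], so that congruence conditions on them are decided by
    computation. *)
Definition trit (r : int) := r = 0 \/ r = 1 \/ r = -1.

Lemma isEis_trit x : isEis x -> exists2 r, trit r & congE x r%:~R.
Proof.
case/isEis_residue => h; [exists 0 | exists 1 | exists (-1)] => //; rewrite /trit; tauto.
Qed.

Lemma congE_int (m n : int) : congE (m%:~R : C) n%:~R -> (3 %| m - n)%Z.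
Proof.
move=> h; apply: (@congE_int0 R); rewrite intrB.
by have := congED h (congE_refl (- n%:~R : C)); rewrite subrr.
Qed.

(** Conjugation acts trivially modulo [θ], so the hermitian norm reduces to a quadratic form over
    [F_3]. *)
Lemma herm_cong w (r0 r1 r2 r3 n : int) : Evec w -> herm w w = n%:~R ->
  congE (w o0 0) r0%:~R -> congE (w o1 0) r1%:~R ->
  congE (w o2 0) r2%:~R -> congE (w o3 0) r3%:~R ->
  (3 %| n - (r0 * r0 - r1 * r1 - r2 * r2 - r3 * r3))%Z.
Proof.
move=> ew hw h0 h1 h2 h3; apply: congE_int; rewrite -hw hermE !intrB !intrM.
have q i (r : int) : congE (w i 0) r%:~R -> congE ((w i 0)^* * w i 0) (r%:~R * r%:~R).
  move=> h; apply: congEM => //; [exact: isEis_conj | exact: isEis_int |].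
  by rewrite -(rmorph_int Num.conj); apply: congE_conj.
by do 3?[apply: congED; last by apply: congEN; apply: q]; apply: q.
Qed.

Definition sgn x := x = 1 \/ x = -1.

Definition signs (d0 d1 d2 d3 : C) : 'M[C]_4 := diag_mx (\row_i nth 0 [:: d0; d1; d2; d3] i).

Lemma signs_G3 d0 d1 d2 d3 : sgn d0 -> sgn d1 -> sgn d2 -> sgn d3 ->
  G3 (signs d0 d1 d2 d3).
Proof.
have es x : sgn x -> isEis x by case=> ->; [exact: isEis1 | apply: isEisN; exact: isEis1].
have ss x : sgn x -> x * x^* = 1 by case=> ->; rewrite ?rmorphN1 ?rmorph1; ring.
move=> h0 h1 h2 h3; apply: diag_G3; elim/forall_ord4; rewrite mxE /=; by [exact: es | exact: ss].
Qed.

Lemma signsE d0 d1 d2 d3 z i :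
  (signs d0 d1 d2 d3 *m z) i 0 = nth 0 [:: d0; d1; d2; d3] i * z i 0.
Proof. by rewrite /signs mul_diag_mx !mxE. Qed.

(* The biflection along [(1, 0, 1, 1)]. *)
Definition bifl : 'M[C]_4 := mx4
  [:: [:: 3; 0; -2; -2]; [:: 0; 1; 0; 0]; [:: 2; 0; -1; -2]; [:: 2; 0; -2; -1]].

Lemma bifl_G3 : G3 bifl.
Proof.
apply: G3I.
  have E n : isEis (n%:~R : C) by exact: isEis_int.
  have E0 := E 0; have E1 := E 1; have E2 := E 2; have E3 := E 3.
  have N1 := isEisN E1; have N2 := isEisN E2.
  by elim/forall_ord4; elim/forall_ord4; rewrite mxE.
move=> z w; rewrite !hermE !mxE !sum_ord4 !mxE /=.
move: (z o0 0) (z o1 0) (z o2 0) (z o3 0) => p0 p1 p2 p3.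
move: (w o0 0) (w o1 0) (w o2 0) (w o3 0) => q0 q1 q2 q3.
rewrite !(rmorphD, rmorphN, rmorphM, rmorph0, rmorph1) /=.
by ring.
Qed.

(** Modulo [θ], [w] is a vector of norm [-1] for [x_0^2 - x_2^2 - x_3^2] over [F_3]. Up to signs it
    is [e_3], [e_2] or [(1, 0, 1, 1)], reached from [e_3] by sign changes, a transposition and the
    biflection respectively. *)
Lemma stab_lift w : Evec w -> herm w w = -1 -> congE (w o1 0) 0 ->
  exists k, [/\ G3 k, k *m e_ o1 = e_ o1 & mcong (k *m e_ o3) w].
Proof.
move=> ew hw h1.
have [r0 t0 h0] := isEis_trit (ew o0).
have [r2 t2 h2] := isEis_trit (ew o2).
have [r3 t3 h3] := isEis_trit (ew o3).
have := @herm_cong w r0 0 r2 r3 (-1) ew hw h0 h1 h2 h3.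
suff : (3 %| -1 - (r0 * r0 - 0 * 0 - r2 * r2 - r3 * r3))%Z ->
  exists k, [/\ G3 k, k *m e_ o1 = e_ o1 &
  [/\ congE ((k *m e_ o3) o0 0) r0%:~R, congE ((k *m e_ o3) o1 0) 0,
   congE ((k *m e_ o3) o2 0) r2%:~R & congE ((k *m e_ o3) o3 0) r3%:~R]].
  move=> H /H[k [hk k1 [c0 c1 c2 c3]]]; exists k; split => // i j; rewrite (ord1 j).
  by move: i; elim/forall_ord4; (apply: congE_trans; last by apply: congE_sym; eassumption).
move=> dv; have S1 : sgn 1 by left.
have St (r : int) : r = 1 \/ r = -1 -> sgn r%:~R by case=> ->; [left | right].
have [[z0 z2 s3]|[z0 s2 z3]|[s0 s2 s3]] : [\/ [/\ r0 = 0, r2 = 0 & r3 = 1 \/ r3 = -1],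
    [/\ r0 = 0, r2 = 1 \/ r2 = -1 & r3 = 0] |
    [/\ r0 = 1 \/ r0 = -1, r2 = 1 \/ r2 = -1 & r3 = 1 \/ r3 = -1]].
  move: dv; case: t0 t2 t3 => [->|[->|->]] [->|[->|->]] [->|[->|->]] //= _;
  by [constructor 1; split => //; tauto | constructor 2; split => //; tauto |
    constructor 3; split; tauto].
- exists (signs 1 1 1 r3%:~R); split; first by apply: signs_G3 => //; exact: St.
    by apply/matrixP => i j; rewrite (ord1 j); move: i; elim/forall_ord4;
      rewrite signsE !mxE /=; ring.
  rewrite !signsE !mxE /= z0 z2 !mulr0 mulr1; split; exact: congE_refl.
- exists (signs 1 1 r2%:~R 1 *m tperm_mx o3 o2); split.
  + by apply: G3M; [apply: signs_G3 => //; exact: St | exact: tperm_G3].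
  + rewrite -mulmxA (_ : tperm_mx o3 o2 *m e_ o1 = e_ o1).
      by apply/matrixP => i j; rewrite (ord1 j); move: i; elim/forall_ord4;
        rewrite signsE !mxE /=; ring.
    rewrite -row_permE; apply/matrixP => i j; rewrite !mxE; congr (nat_of_bool (_ && _))%:R.
    by rewrite -{1}(tpermD (x := o3) (y := o2) (z := o1)) // (inj_eq perm_inj).
  rewrite -!mulmxA tperm_mx_delta !signsE !mxE /= z0 z3 !mulr0 mulr1; split; exact: congE_refl.
(* The biflection sends [e_3] to [(-2, 0, -2, -1)], congruent to [(1, 0, 1, -1)]; hence the sign
   before [r3]. *)
exists (signs r0%:~R 1 r2%:~R (- r3%:~R) *m bifl); split.
- apply: G3M bifl_G3; apply: signs_G3 => //; try exact: St.
  by case: s3 => ->; [right | left; rewrite opprK].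
- by rewrite -mulmxA; apply/matrixP => i j; rewrite (ord1 j); move: i; elim/forall_ord4;
    rewrite signsE !mxE !sum_ord4 !mxE /=; ring.
have c (r : int) : congE (r%:~R * -2 : C) r%:~R.
  have := congED (@congE_mul3 R (- r)) (congE_refl (r%:~R : C)).
  by rewrite add0r intrN; congr congE; ring.
rewrite -mulmxA !signsE !mxE !sum_ord4 !mxE /= !(mulr0, add0r, mulr1, mulrN1, opprK).
by split; [exact: c | exact: congE_refl | exact: c | exact: congE_refl].
Qed.

Lemma signs_delta d0 d1 d2 d3 j :
  signs d0 d1 d2 d3 *m e_ j = nth 0 [:: d0; d1; d2; d3] j *: e_ j.
Proof.
apply/matrixP => i l; rewrite (ord1 l) signsE !mxE andbT.
by case: eqP => [->|] //; rewrite !mulr0.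
Qed.

Lemma herm_delta_r z (j : 'I_4) :
  herm z (e_ j) = (if j == ord0 then 1 else -1) * (z j 0)^*.
Proof. by elim/forall_ord4: j; rewrite hermE !mxE /=; ring. Qed.

(** By unitarity, coordinate [i] of [invmx g *m e_ j] is, up to sign, the conjugate of coordinate
    [j] of [g *m e_ i]. *)
Lemma orth_cong g (i j : 'I_4) : G3 g -> i != ord0 ->
  congE ((g *m e_ i) j 0) 0 -> congE ((invmx g *m e_ j) i 0) 0.
Proof.
move=> hg hi h; have [_ ug _ hh] := hg.
have : herm (e_ i) (invmx g *m e_ j) = herm (g *m e_ i) (e_ j).
  by rewrite -hh mulmxA mulmxV // mul1mx.
rewrite herm_delta // herm_delta_r => /(congr1 -%R); rewrite opprK => ->.
have c0 : congE ((g *m e_ i) j 0)^* 0 by rewrite -(conjC0 C); exact: congE_conj.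
case: ifP => _; first by rewrite mul1r; have := congEN c0; rewrite oppr0.
by rewrite mulN1r opprK.
Qed.

Lemma mul_lift g k (j : 'I_4) : G3 g -> mcong (k *m e_ j) (invmx g *m e_ j) ->
  mcong (g *m k *m e_ j) (e_ j).
Proof.
move=> [eg ug ei _] h; rewrite -mulmxA -[e_ j in X in mcong _ X]mul1mx -(mulmxV ug) -mulmxA.
apply: mcongM => //; last exact: mcong_refl.
by apply: EmxM => //; exact: Emx_delta.
Qed.

(** Right multiplication by elements fixing [e_1] makes [g] fix [e_3], [e_2] and [e_0] modulo [θ],
    in this order, without moving [g *m e_ o1]. *)
Lemma frame_lift g s : G3 g -> sgn s -> mcong (g *m e_ o1) (s *: e_ o1) ->
  exists2 k, G3s3 k & g *m e_ o1 = s *: (k *m e_ o1).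
Proof.
move=> hg ss ca.
have S1 : sgn 1 by left.
have Einv g' (j : 'I_4) : G3 g' -> Evec (invmx g' *m e_ j).
  by move=> hg'; apply: Evec_mul; [exact: G3V | move=> i; exact: Emx_delta].
have Hinv g' (j : 'I_4) : G3 g' ->
    herm (invmx g' *m e_ j) (invmx g' *m e_ j) = herm (e_ j) (e_ j).
  by move=> /G3V[_ _ _ ->].
have a0 g' j : g' *m e_ o1 = g *m e_ o1 -> j != o1 -> congE ((g' *m e_ o1) j 0) 0.
  move=> -> hj; have := ca j 0.
  by rewrite [X in congE _ X]mxE [X in congE _ (_ * X)]mxE (negPf hj) mulr0.
have d0 g' (i j : 'I_4) : mcong (g' *m e_ i) (e_ i) -> j != i -> congE ((g' *m e_ i) j 0) 0.
  by move=> h hj; have := h j 0; rewrite [X in congE _ X]mxE (negPf hj).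
have [k1 [hk1 k11 k13]] : exists k, [/\ G3 k, k *m e_ o1 = e_ o1 &
    mcong (k *m e_ o3) (invmx g *m e_ o3)].
  apply: stab_lift; first exact: Einv.
    by rewrite Hinv // herm_delta // mxE.
  by apply: orth_cong => //; exact: a0.
pose g1 := g *m k1; have hg1 : G3 g1 by exact: G3M.
have g11 : g1 *m e_ o1 = g *m e_ o1 by rewrite -mulmxA k11.
have g13 : mcong (g1 *m e_ o3) (e_ o3) by exact: mul_lift.
clearbody g1.
(* Modulo [θ] the preimage of [e_2] is orthogonal to [e_1] and [e_3], so [r0^2 - r2^2 = -1] in
   [F_3]. As 2 is not a square there, [r0 = 0] and [r2] is a sign. *)
have [r2 s2 c2] : exists2 r2 : C, sgn r2 & mcong (r2 *: e_ o2) (invmx g1 *m e_ o2).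
  set w := invmx g1 *m e_ o2; have ew : Evec w by exact: Einv.
  have w1 : congE (w o1 0) 0%:~R by apply: orth_cong => //; exact: a0.
  have w3 : congE (w o3 0) 0%:~R by apply: orth_cong => //; exact: d0.
  have [r0 t0 h0] := isEis_trit (ew o0); have [r2 t2 h2] := isEis_trit (ew o2).
  have hw : herm w w = (-1)%:~R by rewrite Hinv // herm_delta // mxE.
  have dv := herm_cong ew hw h0 w1 h2 w3.
  have [z0 z2] : r0 = 0 /\ (r2 = 1 \/ r2 = -1).
    by move: dv; case: t0 t2 => [->|[->|->]] [->|[->|->]] //= _; tauto.
  clearbody w; exists r2%:~R; first by case: z2 => ->; [left | right].
  move=> i j; rewrite (ord1 j); apply: congE_sym; move: i; elim/forall_ord4;
    rewrite !mxE /= ?mulr0 ?mulr1 //.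
  by rewrite z0 in h0.
pose g2 := g1 *m signs 1 1 r2 1.
have hg2 : G3 g2 := G3M hg1 (signs_G3 S1 S1 s2 S1).
have g21 : g2 *m e_ o1 = g *m e_ o1 by rewrite -mulmxA signs_delta scale1r.
have g23 : mcong (g2 *m e_ o3) (e_ o3) by rewrite -mulmxA signs_delta scale1r.
have g22 : mcong (g2 *m e_ o2) (e_ o2) by apply: (mul_lift hg1); rewrite signs_delta; exact: c2.
clearbody g2.
have [r0 s0 c0] : exists2 r0 : C, sgn r0 & mcong (r0 *: e_ o0) (invmx g2 *m e_ o0).
  set w := invmx g2 *m e_ o0; have ew : Evec w by exact: Einv.
  have w1 : congE (w o1 0) 0%:~R by apply: orth_cong => //; exact: a0.
  have w2 : congE (w o2 0) 0%:~R by apply: orth_cong => //; exact: d0.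
  have w3 : congE (w o3 0) 0%:~R by apply: orth_cong => //; exact: d0.
  have [r0 t0 h0] := isEis_trit (ew o0).
  have hw : herm w w = 1%:~R by rewrite Hinv // herm_delta_r mxE /= mul1r conjC1.
  have dv := herm_cong ew hw h0 w1 w2 w3.
  have z0 : r0 = 1 \/ r0 = -1.
    by move: dv; case: t0 => [->|[->|->]] //= _; tauto.
  clearbody w; exists r0%:~R; first by case: z0 => ->; [left | right].
  by move=> i j; rewrite (ord1 j); apply: congE_sym; move: i; elim/forall_ord4;
    rewrite !mxE /= ?mulr0 ?mulr1.
pose g3 := g2 *m signs r0 1 1 1.
have hg3 : G3 g3 := G3M hg2 (signs_G3 s0 S1 S1 S1).
have g31 : g3 *m e_ o1 = g *m e_ o1 by rewrite -mulmxA signs_delta scale1r.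
have g33 : mcong (g3 *m e_ o3) (e_ o3) by rewrite -mulmxA signs_delta scale1r.
have g32 : mcong (g3 *m e_ o2) (e_ o2) by rewrite -mulmxA signs_delta scale1r.
have g30 : mcong (g3 *m e_ o0) (e_ o0) by apply: (mul_lift hg2); rewrite signs_delta; exact: c0.
clearbody g3.
have sc : s * s = 1 by case: ss => ->; ring.
have es : isEis s by case: ss => ->; [exact: isEis1 | apply: isEisN; exact: isEis1].
(* The sign at [e_1] turns the residue [s] into 1, making the product congruent to the identity. *)
exists (g3 *m signs 1 s 1 1); last first.
  by rewrite -mulmxA signs_delta /= -scalemxAr scalerA sc scale1r g31.
split; first exact: G3M hg3 (signs_G3 S1 ss S1 S1).
move=> i j.
have -> : (g3 *m signs 1 s 1 1) i j = (g3 *m signs 1 s 1 1 *m e_ j) i 0.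
  by rewrite -colE [RHS]mxE.
have -> : (1%:M : 'M[C]_4) i j = (e_ j) i 0 by rewrite !mxE andbT.
rewrite -mulmxA signs_delta.
suff : mcong (g3 *m (nth 0 [:: 1; s; 1; 1] j *: e_ j)) (e_ j) by apply.
elim/forall_ord4: j => /=; rewrite ?scale1r // -scalemxAr g31 => {}i l.
rewrite mxE -[(e_ o1) i l](mul1r) -sc -mulrA.
by apply: congEM => //; [rewrite mxE; apply: isEisM => //; exact: (isEis_int _ (_ && _)) |
   exact: congE_refl | have := ca i l; rewrite [X in congE _ X]mxE].
Qed.

(** A transposition reduces to [i = 1], where transitivity of [G3] and the frame correction apply;
    normality of the congruence subgroup undoes the transposition. *)
Lemma orbit_cong a (i : 'I_4) s : Evec a -> herm a a = -1 -> i != ord0 -> sgn s ->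
  (forall j, congE (a j 0) (s * e_ i j 0)) ->
  exists2 g, G3s3 g & a = s *: (g *m e_ i).
Proof.
move=> ea ha hi ss ca.
pose P : 'M[C]_4 := tperm_mx i o1.
have hP : G3 P by exact: tperm_G3.
have [eP uP _ hh] := hP.
have [g hg ga] := reach_all (Evec_mul hP ea) (etrans (hh a a) ha).
have [|k hk kE] := frame_lift hg ss.
  rewrite ga -(tperm_mx_delta R i o1) -/P scalemxAr; apply: mcongM => //; [|exact: mcong_refl|].
    move=> j l; rewrite mxE; apply: isEisM; last exact: Emx_delta.
    by case: ss => ->; [exact: isEis1 | apply: isEisN; exact: isEis1].
  by move=> j l; rewrite (ord1 l) [X in congE _ X]mxE.
exists (invmx P *m k *m P); first exact: G3s3_conjg.
rewrite -!mulmxA tperm_mx_delta scalemxAr -kE ga mulmxA mulVmx //.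
by rewrite mul1mx.
Qed.

Lemma triflection_cong_value (F : 'cV[C]_4 -> C) (v : 'M[C]_4 -> C) a :
  modular_form 1 (@G3s3 R) v F -> zero_divisor_mirrors (@G3s3 R) F ->
  Evec a -> herm a a = -1 -> cong_pm_basis a -> v (triflection a) = ζ.
Proof.
move=> mF zF ea ha [i [hi [s [hs ca]]]].
have [ev [z zB Fz]] := triflection_delta_value mF zF hi.
have [g hg aE] := orbit_cong ea ha hi hs ca.
have [_ _ _ hF _] := mF.
have hgV := G3s3V hg; have [hg3 _] := hg; have [_ ug _ hh] := hg3.
have hb : herm (e_ i) (e_ i) = -1 by rewrite herm_delta // mxE !eqxx.
have gzB : inB (g *m z) by rewrite /inB hh.
have Fgz : F (g *m z) != 0.
  apply: contra_neq Fz => Fgz.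
  by have := hF _ _ hgV gzB; rewrite Fgz mulr0 mulmxA mulVmx // mul1mx.
have Te : G3s3 (triflection (e_ i)).
  by apply: triflection_G3s3 => // j; exact: Emx_delta.
have TzB : inB (triflection (e_ i) *m z) by case: Te => [[_ _ _ h] _]; rewrite /inB h.
have sc : s * s^* = 1 by case: hs => ->; rewrite ?rmorphN1 ?rmorph1; ring.
(* The triflection along [a] is the conjugate by [g] of the one along [e_i]. Evaluating [F] at this
   point in two ways, where nothing vanishes, identifies their character values. *)
have E : F (g *m (triflection (e_ i) *m z)) = v (triflection a) * F (g *m z).
  rewrite -(hF _ _ (triflection_G3s3 ea ha) gzB) !mulmxA -(triflection_conj hg3 hb).
  by rewrite -(triflectionZ _ sc) -aE.
have E1 := hF _ _ hg TzB; have E2 := hF _ _ Te zB; have E3 := hF _ _ hg zB.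
by apply: (mulIf Fgz); rewrite -E E1 E2 E3 ev; exact: mulrCA.
Qed.

End Lift.

Theorem theorem6p2 (R : realType) (F : 'cV[CC R]_4 -> CC R)
    (v : 'M[CC R]_4 -> CC R) :
  modular_form 1 (@G3s3 R) v F ->
  zero_divisor_mirrors (@G3s3 R) F ->
  forall a : 'cV[CC R]_4, Evec a -> herm a a = -1 ->
    (cong_pm_basis a -> v (triflection a) = zeta R) /\
    (~ cong_pm_basis a -> v (triflection a) = 1).
Proof.
move=> mF zF a ea ha; split.
- exact: triflection_cong_value mF zF ea ha.
- exact: triflection_trivial_value mF zF ea ha.
Qed.
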